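(* Let $f\in C(\Omega)\cap L^\infty(\Omega)$, $g\in C(\partial\Omega)$ and $0<\varepsilon<1$. There exists an at most countable set $\mathcal{N}_\varepsilon\subseteq\mathbb{R}$ such that the problem $$-\Delta^\varepsilon_\infty u=f+c\ \text{ in }\Omega,\qquad u=g\ \text{ on }\partial\Omega$$ has a unique bounded solution $u:\bar\Omega\to\mathbb{R}$ for every $c\in\mathbb{R}\setminus\mathcal{N}_\varepsilon$.
   Context: $\Omega\subseteq\mathbb{R}^n$ is a bounded, connected, open set. For $x,y\in\bar\Omega$, $d(x,y)$ is the path distance: the infimum of the lengths of Lipschitz paths $\gamma:[0,1]\to\bar\Omega$ with $\gamma(0)=x$, $\gamma(1)=y$. It is assumed that $\operatorname{diam}(\Omega):=\sup\{d(x,y):x,y\in\bar\Omega\}<\infty$. Write $\bar\Omega(x,r):=\{y\in\bar\Omega: d(x,y)\le r\}$. For $\varepsilon>0$ set $\rho_\varepsilon(x,y):=\max\{d(x,y),\varepsilon\}$ if $x,y\in\Omega$, and $\rho_\varepsilon(x,y):=d(x,y)$ if $x\in\partial\Omega$ or $y\in\partial\Omega$. For $u:\bar\Omega\to\mathbb{R}$ and $x\in\Omega$, $$S^+_\varepsilon u(x):=\sup_{y\in\bar\Omega(x,\varepsilon)}\frac{u(y)-u(x)}{\rho_\varepsilon(x,y)},\quad S^-_\varepsilon u(x):=\sup_{y\in\bar\Omega(x,\varepsilon)}\frac{u(x)-u(y)}{\rho_\varepsilon(x,y)},\quad \Delta^\varepsilon_\infty u(x):=\frac1\varepsilon\big(S^+_\varepsilon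 u(x)-S^-_\varepsilon u(x)\big).$$ The equation is understood pointwise. *)

(* Defs.v *)
From mathcomp Require Import all_boot all_order all_algebra.
From mathcomp Require Import all_classical all_reals all_analysis.

Set Implicit Arguments.
Unset Strict Implicit.
Unset Printing Implicit Defensive.

Import Order.TTheory GRing.Theory Num.Theory.
Import numFieldNormedType.Exports.

Local Open Scope classical_set_scope.
Local Open Scope ring_scope.

Section PathDistance.
Context {R : realType} {n : nat}.
Implicit Types (Omega : set 'rV[R]_n) (x y : 'rV[R]_n) (gamma : R -> 'rV[R]_n).

(* The library norm on 'rV[R]_n is the maximum norm; it gives the usual
   topology, the usual bounded sets and the usual Lipschitz maps, but lengths
   have to be measured with the Euclidean norm. *)
Definition enorm x : R := Num.sqrt (\sum_(i < n) x ord0 i ^+ 2).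

(* For s in itv_partition 0 1, the subdivision of [0, 1] is 0 :: s. *)
Definition path_length gamma : \bar R :=
  ereal_sup [set (\sum_(0 <= k < size s)
      enorm (gamma (nth 1 (0 :: s) k.+1) - gamma (nth 1 (0 :: s) k)))%:E
    | s in itv_partition (0 : R) 1].

Definition lipschitz_path Omega x y gamma : Prop :=
  [/\ [lipschitz gamma t | t in `[0, 1]],
      forall t, t \in `[0, 1] -> closure Omega (gamma t),
      gamma 0 = x & gamma 1 = y].

(* Equal to +oo when no Lipschitz path in closure Omega joins x to y. *)
Definition path_edist Omega x y : \bar R :=
  ereal_inf [set path_length gamma | gamma in lipschitz_path Omega x y].

Definition path_diam Omega : \bar R :=
  ereal_sup [set path_edist Omega p.1 p.2
    | p in closure Omega `*` closure Omega].

(* Meaningful for x and y in closure Omega when path_diam Omega < +oo. *)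
Definition path_dist Omega x y : R := fine (path_edist Omega x y).

Definition boundary Omega : set 'rV[R]_n := closure Omega `\` interior Omega.

Definition path_cball Omega x (r : R) : set 'rV[R]_n :=
  [set y | closure Omega y /\ path_dist Omega x y <= r].

End PathDistance.

Section FiniteDifference.
Context {R : realType} {n : nat}.
Implicit Types (Omega : set 'rV[R]_n) (eps : R) (u f g : 'rV[R]_n -> R).
Implicit Types (x y : 'rV[R]_n).

(* For Omega open and x, y in closure Omega, the second case is exactly
   "x or y is in the boundary of Omega". *)
Definition rho Omega eps x y : R :=
  if (x \in Omega) && (y \in Omega) then Num.max (path_dist Omega x y) eps
  else path_dist Omega x y.

Definition slope_plus Omega eps u x : \bar R :=
  ereal_sup [set ((u y - u x) / rho Omega eps x y)%:E
    | y in path_cball Omega x eps].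

Definition slope_minus Omega eps u x : \bar R :=
  ereal_sup [set ((u x - u y) / rho Omega eps x y)%:E
    | y in path_cball Omega x eps].

(* Both slopes are finite when u is bounded on closure Omega and x is a point
   of the open set Omega. *)
Definition inf_laplacian Omega eps u x : \bar R :=
  ((eps^-1)%:E * (slope_plus Omega eps u x - slope_minus Omega eps u x))%E.

(* Functions on Omega, on its boundary or on its closure are encoded as total
   functions of which only the values on the relevant set are used. *)
Definition bounded_solution Omega eps f g u : Prop :=
  [/\ [bounded u x | x in closure Omega],
      forall x, Omega x -> (- inf_laplacian Omega eps u x)%E = (f x)%:E
    & forall x, boundary Omega x -> u x = g x].

End FiniteDifference.

(* Main.v *)
Require Import Defs.
From mathcomp Require Import all_boot all_order all_algebra.
From mathcomp Require Import all_classical all_reals all_analysis.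
From mathcomp Require Import ring lra.

(** Write h = eps (f + c).  The equation says S^- u - S^+ u = h on Omega, and
    it only involves differences of values of u on eps-balls, weighted by rho,
    so all estimates below are made at single points.

    Comparison with a strict gap is elementary ([comparison]).  Suppose that
    the right-hand side of v exceeds that of u by d > 0, that u <= v on the
    boundary, and that x almost maximizes u - v > 0.  Every increment of u from
    x is then at most the corresponding increment of v, up to a small error on
    interior points and with no error on boundary points.  So
    S^+ u <= S^+ v and S^- v <= S^- u at x up to a small error, against the
    gap d.

    Existence holds for every c: the pointwise supremum of all subsolutions with
    the right boundary values is a solution, because raising it at one point
    keeps every other inequality.  Perron's method needs barriers, and these are
    concave functions of the least number of eps-steps that lead from x to the
    boundary.  That number is bounded because the path diameter is finite:
    a path of length at most L can be cut into boundedly many pieces of length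
    at most eps ([reach_path]).

    Uniqueness fails for countably many c only.  Let u and v be two solutions
    for the same c, and let M = sup (v - u) > 0.  At a point where v - u almost
    equals M, the slopes S^+ u and S^+ v almost agree, and an almost optimal
    uphill step stays inside Omega and almost preserves the gap M
    ([gap_step]).  Such steps cannot all raise v by a fixed amount, so at some x
    the uphill slopes are small compared with M ([gap_top]): u stays below
    v x on the whole eps-ball around x.  So some set Q of a fixed countable
    family and some rational q satisfy u <= q on Q and q < v y for some y in Q.
    By comparison, solutions for c lie below solutions for c' > c, so a pair
    (Q, q) serves at most one value of c ([nonuniqueness_countable]). *)

Set Implicit Arguments.
Unset Strict Implicit.
Unset Printing Implicit Defensive.

Import Order.TTheory GRing.Theory Num.Theory.
Import numFieldNormedType.Exports.
Local Open Scope classical_set_scope.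
Local Open Scope ring_scope.

(** * Slopes on an abstract stencil *)

Section Stencil.
Context {R : realType} {T : Type}.

(** What the argument uses of the domain: nb x is the closed eps-ball around x,
    Om the open set and bd its boundary.  Weights equal eps on interior
    neighbours, are at most eps on boundary neighbours, and at a fixed x they
    are bounded away from 0, which keeps the slopes finite. *)
Record stencil (Om bd : set T) (nb : T -> set T) (rho : T -> T -> R)
    (eps : R) : Prop := Stencil {
  stencil_eps : 0 < eps;
  stencil_self : forall x, Om x -> nb x x;
  stencil_cover : forall x y, Om x -> nb x y -> Om y \/ bd y;
  stencil_disj : forall x, Om x -> ~ bd x;
  stencil_in : forall x y, Om x -> nb x y -> Om y -> rho x y = eps;
  stencil_bd : forall x y, Om x -> nb x y -> bd y -> rho x y <= eps;
  stencil_low : forall x, Om x ->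
    exists2 r, 0 < r & forall y, nb x y -> r <= rho x y }.

Context {Om bd : set T} {nb : T -> set T} {rho : T -> T -> R} {eps : R}.
Context (S : stencil Om bd nb rho eps).
Implicit Types (u v w g h : T -> R) (x y : T).

Definition bounded_on u := exists B, forall x, Om x \/ bd x -> `|u x| <= B.

Definition slope u x := sup [set (u y - u x) / rho x y | y in nb x].

(** This is - eps times the finite difference infinity Laplacian: the slope of
    - u is the downward slope S^- of u. *)
Definition slope_gap u x := slope (\- u) x - slope u x.

Let eps0 : 0 < eps := stencil_eps S.

Lemma rho_gt0 x y : Om x -> nb x y -> 0 < rho x y.
Proof.
move=> Ox xy; have [r r0 /(_ _ xy)] := stencil_low S Ox.
exact: lt_le_trans.
Qed.

Lemma ler_div_rho x y a b : Om x -> nb x y -> a <= b ->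
  a / rho x y <= b / rho x y.
Proof.
by move=> Ox xy ab; rewrite ler_wpM2r// invr_ge0 ltW//; exact: rho_gt0.
Qed.

Lemma bounded_onN {u} : bounded_on u -> bounded_on (\- u).
Proof. by move=> [B uB]; exists B => x Dx; rewrite /= normrN; exact: uB. Qed.

Lemma slope_gapN u x : slope_gap (\- u) x = - slope_gap u x.
Proof.
rewrite /slope_gap opprB; congr (slope _ x - _).
by apply/funext => y /=; rewrite opprK.
Qed.

Lemma slope_has_ubound u x : Om x -> bounded_on u ->
  has_ubound [set (u y - u x) / rho x y | y in nb x].
Proof.
move=> Ox [B uB]; have [r r0 hr] := stencil_low S Ox.
exists ((B + B) / r) => _ [y xy <-].
have ry := rho_gt0 Ox xy.
have /ler_normlP[_ uy] := uB _ (stencil_cover S Ox xy).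
have /ler_normlP[ux ux'] := uB x (or_introl Ox).
have BB : 0 <= B + B by lra.
apply: (@le_trans _ _ ((B + B) / rho x y)).
  by rewrite ler_wpM2r ?invr_ge0 ?(ltW ry)//; lra.
by rewrite ler_wpM2l// lef_pV2 ?posrE ?hr.
Qed.

Lemma slope_ub u x y : Om x -> bounded_on u -> nb x y ->
  (u y - u x) / rho x y <= slope u x.
Proof.
by move=> Ox bu xy; apply: ub_le_sup; [exact: slope_has_ubound|exists y].
Qed.

Lemma slope_le u x c : Om x ->
  (forall y, nb x y -> (u y - u x) / rho x y <= c) -> slope u x <= c.
Proof.
move=> Ox H; apply: ge_sup => [|_ [y xy <-]]; last exact: H.
by exists ((u x - u x) / rho x x), x => //; exact: (stencil_self S).
Qed.

Lemma slope_adherent u x e : Om x -> bounded_on u -> 0 < e ->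
  exists2 y, nb x y & slope u x - e < (u y - u x) / rho x y.
Proof.
move=> Ox bu e0.
have [|_ [y xy <-] ?] := @sup_adherent R
    [set (u y - u x) / rho x y | y in nb x] _ e0; last by exists y.
split; last exact: slope_has_ubound.
by exists ((u x - u x) / rho x x), x => //; exact: (stencil_self S).
Qed.

Lemma slope_increment u x y : Om x -> Om y -> bounded_on u -> nb x y ->
  u y - u x <= eps * slope u x.
Proof.
move=> Ox Oy bu xy; have := slope_ub Ox bu xy.
by rewrite (stencil_in S)// ler_pdivrMr// mulrC.
Qed.

(** Boundary neighbours may have arbitrarily small weights, so the error e is
    only allowed at interior points, where the weight is exactly eps. *)
Lemma contact_slope u v x e : Om x -> bounded_on v -> 0 <= e ->
    (forall y, Om y -> u y - v y <= u x - v x + e) ->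
    (forall y, bd y -> u y - v y <= u x - v x) ->
  slope u x <= slope v x + e / eps.
Proof.
move=> Ox bv e0 hO hb; apply: slope_le => // y xy.
have vy := slope_ub Ox bv xy.
have r0 := rho_gt0 Ox xy.
have e1 : 0 <= e / eps by rewrite divr_ge0// ltW.
have [Oy|by_] := stencil_cover S Ox xy.
  apply: (@le_trans _ _ ((v y - v x) / rho x y + e / eps)); last lra.
  rewrite -(stencil_in S Ox xy Oy) -mulrDl ler_div_rho//.
  by have := hO _ Oy; lra.
apply: (@le_trans _ _ ((v y - v x) / rho x y)); last lra.
rewrite ler_div_rho//.
by have := hb _ by_; lra.
Qed.

Lemma contact_slope_gap u v x e :
    Om x -> bounded_on u -> bounded_on v -> 0 <= e ->
    (forall y, Om y -> u y - v y <= u x - v x + e) ->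
    (forall y, bd y -> u y - v y <= u x - v x) ->
  slope_gap v x <= slope_gap u x + 2 * (e / eps).
Proof.
move=> Ox bu bv e0 hO hb.
have up := contact_slope Ox bv e0 hO hb.
have dn : slope (\- v) x <= slope (\- u) x + e / eps.
  by apply: contact_slope => // [|y /hO|y /hb] /=; [exact: bounded_onN|lra|lra].
by rewrite /slope_gap; lra.
Qed.

Lemma gap_sup u v x0 : bounded_on u -> bounded_on v -> Om x0 ->
  exists M, [/\ forall x, Om x -> u x - v x <= M, u x0 - v x0 <= M
    & forall e, 0 < e -> exists2 x, Om x & M - e < u x - v x].
Proof.
move=> [B uB] [C vC] Ox0; pose A := [set u x - v x | x in Om].
have ubA : has_ubound A.
  exists (B + C) => _ [x Ox <-].
  have /ler_normlP[_ ?] := uB _ (or_introl Ox).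
  by have /ler_normlP[? _] := vC _ (or_introl Ox); lra.
have A0 : A !=set0 by exists (u x0 - v x0), x0.
exists (sup A); split=> [x Ox||e e0].
- by apply: ub_le_sup => //; exists x.
- by apply: ub_le_sup => //; exists x0.
- by have [_ [x Ox <-] ?] := sup_adherent e0 (conj A0 ubA); exists x.
Qed.

(** An almost maximum point x of u - v with u x > v x satisfies the hypotheses
    of [contact_slope_gap]: on the boundary u - v <= 0 <= u x - v x. *)
Lemma comparison u v d : bounded_on u -> bounded_on v -> 0 < d ->
    (forall x, Om x -> slope_gap u x + d <= slope_gap v x) ->
    (forall x, bd x -> u x <= v x) ->
  forall x, Om x -> u x <= v x.
Proof.
move=> bu bv d0 uv uvb x0 Ox0; rewrite leNgt; apply/negP => lt0.
have [M [hM M0 hadh]] := gap_sup bu bv Ox0.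
(* The error 2 e / eps of the contact estimate is at most d / 2. *)
pose e := Num.min M (d * eps / 4).
have e0 : 0 < e by rewrite /e lt_min !mulr_gt0// andbT; lra.
have eM : e <= M by rewrite /e ge_min lexx.
have ed : e / eps <= d / 4.
  by rewrite ler_pdivrMr// /e mulrAC ge_min lexx orbT.
have [x Ox xM] := hadh _ e0.
have : slope_gap v x <= slope_gap u x + 2 * (e / eps).
  by apply: contact_slope_gap => // [|y /hM|y /uvb]; [exact: ltW|lra|lra].
by have := uv _ Ox; lra.
Qed.

(** * Perron's method *)

Definition subsolution h g w :=
  [/\ bounded_on w, forall x, Om x -> slope_gap w x <= h x
    & forall x, bd x -> w x = g x].

Definition perron h g x := sup [set w x | w in subsolution h g].

Section Perron.
Context (h g : T -> R) (B : R).
Context (leB : forall w, subsolution h g w ->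
  forall x, Om x \/ bd x -> w x <= B).
Context (w0 : T -> R).
Context (sub0 : subsolution h g w0).

Lemma perron_ub w x : Om x \/ bd x -> subsolution h g w -> w x <= perron h g x.
Proof.
move=> Dx sw; apply: ub_le_sup; last by exists w.
by exists B => _ [w' sw' <-]; exact: leB.
Qed.

Lemma perron_adherent x e : Om x \/ bd x -> 0 < e ->
  exists2 w, subsolution h g w & perron h g x - e < w x.
Proof.
move=> Dx e0; have [|_ [w sw <-] ?] := @sup_adherent R
    [set w x | w in subsolution h g] _ e0; last by exists w.
split; first by exists (w0 x), w0.
by exists B => _ [w' sw' <-]; exact: leB.
Qed.

Lemma perron_bounded : bounded_on (perron h g).
Proof.
have [[C hC] _ _] := sub0; exists (`|B| + C) => x Dx.
have h1 : perron h g x <= B.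
  by apply: ge_sup => [|_ [w sw <-]]; [exists (w0 x), w0|exact: leB].
have h2 := perron_ub Dx sub0.
have h3 := ler_norm B; have /ler_normlP[h4 h5] := hC _ Dx.
have nB := normr_ge0 B; have C0 : 0 <= C by exact: le_trans (hC _ Dx).
by rewrite ler_norml; apply/andP; split; lra.
Qed.

Lemma perron_boundary x : bd x -> perron h g x = g x.
Proof.
move=> bx; rewrite /perron.
suff -> : [set w x | w in subsolution h g] = [set g x] by rewrite sup1.
apply/seteqP; split=> [_ [w [_ _ wg] <-]/=|_ -> /=]; first exact: wg.
by exists w0 => //; case: sub0 => _ _; exact.
Qed.

(** Take a subsolution w that nearly attains the supremum at x.  As w lies below
    the supremum at all neighbours, passing from w to the supremum lowers the
    upward slope at x, or raises the downward one, by at most the defect of w at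
    x divided by the least weight at x. *)
Lemma perron_sub x : Om x -> slope_gap (perron h g) x <= h x.
Proof.
move=> Ox; have [r r0 hr] := stencil_low S Ox.
have bp := perron_bounded.
apply/ler_addgt0Pr => e e0.
have er : 0 < e * r / 2 by rewrite divr_gt0// mulr_gt0.
have [w [bw wh wg] wx] := perron_adherent (or_introl Ox) er.
set p := perron h g in bp wx *.
have pw y : nb x y -> w y <= p y.
  by move=> /(stencil_cover S Ox) Dy; exact: perron_ub.
have err y : nb x y -> (p x - w x) / rho x y <= e / 2.
  move=> xy; rewrite ler_pdivrMr ?rho_gt0//.
  have : e / 2 * r <= e / 2 * rho x y.
    by rewrite ler_wpM2l ?hr// divr_ge0// ltW.
  by lra.
have up : slope w x <= slope p x + e / 2.
  apply: slope_le => // y xy; have := slope_ub Ox bp xy.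
  have := err y xy.
  have : (w y - w x) / rho x y <= (p y - p x) / rho x y + (p x - w x) / rho x y.
    by rewrite -mulrDl ler_div_rho//; have := pw _ xy; lra.
  lra.
have dn : slope (\- p) x <= slope (\- w) x + e / 2.
  apply: slope_le => // y xy; have := slope_ub Ox (bounded_onN bw) xy.
  have := err y xy => /=.
  have : (- p y - - p x) / rho x y <=
      (- w y - - w x) / rho x y + (p x - w x) / rho x y.
    by rewrite -mulrDl ler_div_rho//; have := pw _ xy; lra.
  lra.
by have := wh _ Ox; rewrite /slope_gap; lra.
Qed.

(** If the inequality were strict at x, raising the supremum at x alone by a
    small d would give a larger subsolution: at x the slopes move by at most
    d / r, and at every other point raising a neighbour can only increase
    the upward slope and decrease the downward one. *)
Lemma perron_super x : Om x -> h x <= slope_gap (perron h g) x.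
Proof.
move=> Ox; rewrite leNgt; apply/negP => lt.
have [r r0 hr] := stencil_low S Ox.
have bp := perron_bounded; have sp := perron_sub.
have p_ub := perron_ub.
have pg := perron_boundary.
set p := perron h g in bp lt sp pg p_ub.
pose d := (h x - slope_gap p x) * r / 2.
have d0 : 0 < d by rewrite !mulr_gt0//; lra.
pose q y := if `[< y = x >] then p x + d else p y.
have qx : q x = p x + d by rewrite /q; case: asboolP.
have qp y : y <> x -> q y = p y by rewrite /q; case: asboolP.
have le_pq y : p y <= q y by rewrite /q; case: asboolP => // ->; lra.
have le_qp y : q y <= p y + d by rewrite /q; case: asboolP => // [->|]; lra.
have bq : bounded_on q.
  have [C hC] := bp; exists (C + d) => y Dy.
  have := le_pq y; have := le_qp y.
  have /ler_normlP[? ?] := hC _ Dy => ? ?.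
  by rewrite ler_norml; apply/andP; split; lra.
suff /(p_ub _ _ (or_introl Ox)) : subsolution h g q by rewrite qx; lra.
split=> // [y Oy|y byy]; last first.
  rewrite qp; first exact: pg.
  by move=> yx; move: byy; rewrite yx; exact: (stencil_disj S Ox).
have [->|/qp yx] := pselect (y = x).
  have err z : nb x z -> d / rho x z <= (h x - slope_gap p x) / 2.
    move=> xz; rewrite ler_pdivrMr ?rho_gt0//.
    have : (h x - slope_gap p x) / 2 * r <= (h x - slope_gap p x) / 2 * rho x z.
      by rewrite ler_wpM2l ?hr// divr_ge0//; lra.
    by rewrite /d; lra.
  have up : slope p x <= slope q x + (h x - slope_gap p x) / 2.
    apply: slope_le => // z xz; have := slope_ub Ox bq xz.
    have := err z xz.
    have : (p z - p x) / rho x z <= (q z - q x) / rho x z + d / rho x z.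
      rewrite -mulrDl ler_div_rho// qx.
      by have := le_pq z; lra.
    lra.
  have dn : slope (\- q) x <= slope (\- p) x + (h x - slope_gap p x) / 2.
    apply: slope_le => // z xz; have := slope_ub Ox (bounded_onN bp) xz.
    have := err z xz => /=.
    have : (- q z - - q x) / rho x z <=
        (- p z - - p x) / rho x z + d / rho x z.
      rewrite -mulrDl ler_div_rho// qx.
      by have := le_pq z; lra.
    lra.
  by move: up dn; rewrite /slope_gap; lra.
apply: le_trans (sp _ Oy); rewrite /slope_gap lerB//.
  apply: slope_le => // z yz; apply: le_trans (slope_ub Oy (bounded_onN bp) yz).
  rewrite /= yx ler_div_rho//.
  by have := le_pq z; lra.
apply: slope_le => // z yz; apply: le_trans (slope_ub Oy bq yz).
rewrite /= yx ler_div_rho//.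
by have := le_pq z; lra.
Qed.

End Perron.

(** * Barriers and existence *)

(** A chain that meets the boundary early stops there, hence the disjunction;
    it makes reachability monotone in m. *)
Fixpoint reach (m : nat) x : Prop :=
  if m is m'.+1 then bd x \/ exists2 y, nb x y & reach m' y else bd x.

(** The rank of x is the least number of steps to the boundary.  The symmetry
    of nb bounds its growth: from y one can step back to x. *)
Lemma rank_exists K :
    (forall x y, Om x -> Om y -> nb x y -> nb y x) ->
    (forall x, Om x -> reach K x) ->
  exists k : T -> nat, forall x, Om x ->
    [/\ (0 < k x <= K)%N, forall y, Om y -> nb x y -> (k y <= (k x).+1)%N &
        exists2 y, nb x y & bd y \/ Om y /\ (k y < k x)%N].
Proof.
move=> sym hK.
have /choice[k hk] x : exists m, Om x ->
    [/\ reach m x, (m <= K)%N & forall j, reach j x -> (m <= j)%N].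
  have [Ox|nOx] := pselect (Om x); last by exists 0.
  have ex : exists m, `[< reach m x >] by exists K; apply/asboolP/hK.
  exists (ex_minn ex) => _; case: ex_minnP => m /asboolP rm hm.
  by split=> // [|j rj]; apply: hm; apply/asboolP => //; exact: hK.
exists k => x Ox; have [rx kxK kx] := hk _ Ox.
have nbx := stencil_disj S Ox.
split.
- by rewrite kxK andbT lt0n; apply/eqP => k0; move: rx; rewrite k0.
- move=> y Oy xy; have [_ _ ky] := hk _ Oy.
  by apply: ky => /=; right; exists x => //; exact: sym.
case: (k x) rx => [//|m /= [//|[y xy ry]]]; exists y => //.
have [Oy|] := stencil_cover S Ox xy; last by left.
by right; split=> //; have [_ _] := hk _ Oy; exact.
Qed.

Section Existence.
Context (K : nat) (k : T -> nat).
Context (rk : forall x, Om x ->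
    [/\ (0 < k x <= K)%N, forall y, Om y -> nb x y -> (k y <= (k x).+1)%N &
        exists2 y, nb x y & bd y \/ Om y /\ (k y < k x)%N]).

(** In terms of the rank k, the function C + G k has downward slope at least
    (G k - G (k - 1)) / eps and upward slope at most (G (k + 1) - G k) / eps, so
    a second difference of - 2 A eps for G gives the lower bound 2 A.
    The parabola G is chosen to increase up to rank K + 1, which makes the
    comparison of ranks a comparison of values. *)
Lemma barrier g (A C : R) : 0 <= A -> (forall x, bd x -> `|g x| <= C) ->
  exists phi, [/\ bounded_on phi, forall x, Om x -> A <= slope_gap phi x
    & forall x, bd x -> phi x = g x].
Proof.
move=> A0 gC; have [a aE] : exists a, a = A * eps by exists (A * eps).
have a0 : 0 <= a by rewrite aE mulr_ge0// ltW.
have [L LE] : exists L : R, L = K%:R by exists K%:R.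
have K0 : 0 <= L by rewrite LE.
pose G (t : R) := a * t * (2 * L + 2 - t).
have G0 t : 0 <= t <= L + 1 -> 0 <= G t.
  by move=> /andP[? ?]; rewrite !mulr_ge0//; lra.
have Gmono s t : 0 <= s -> s <= t -> t <= L + 1 -> G s <= G t.
  move=> s0 st tK; rewrite -subr_ge0.
  have -> : G t - G s = a * (t - s) * (2 * L + 2 - t - s) by rewrite /G; ring.
  by rewrite !mulr_ge0//; lra.
pose phi x := if `[< bd x >] then g x else C + G (k x)%:R.
have phib x : bd x -> phi x = g x by rewrite /phi; case: asboolP.
have phiO x : Om x -> phi x = C + G (k x)%:R.
  by rewrite /phi => /(stencil_disj S); case: asboolP.
have kK x : Om x -> [/\ (1 <= (k x)%:R :> R), ((k x)%:R <= L :> R)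
    & forall y, Om y -> nb x y -> (k y)%:R <= (k x)%:R + 1 :> R].
  move=> Ox; have [/andP[k0 kK] ky _] := rk Ox; split.
  - by rewrite ler1n.
  - by rewrite LE ler_nat.
  - by move=> y Oy xy; rewrite natr1 ler_nat ky.
have bphi : bounded_on phi.
  exists (`|C| + G (L + 1)) => x [Ox|bx].
    have [? ? _] := kK x Ox.
    rewrite phiO//; apply: le_trans (ler_normD _ _) _; rewrite lerD2l.
    by rewrite ger0_norm; [apply: Gmono; lra|apply: G0; lra].
  rewrite phib//; apply: le_trans (gC _ bx) _.
  by have := ler_norm C; have : 0 <= G (L + 1) by [apply: G0; lra]; lra.
exists phi; split=> // x Ox.
have [k1 kxK kxy] := kK x Ox; have [_ _ [z xz hz]] := rk Ox.
set t := (k x)%:R in k1 kxK kxy.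
have C0 y : bd y -> - C <= g y <= C by move=> /gC; rewrite ler_norml.
have G1 : 0 <= G (t - 1) by apply: G0; lra.
have G2 : G (t - 1) <= G t by apply: Gmono; lra.
have G3 : G t <= G (t + 1) by apply: Gmono; lra.
have up : slope phi x <= (G (t + 1) - G t) / eps.
  apply: slope_le => // y xy.
  have [Oy|by_] := stencil_cover S Ox xy.
    rewrite (stencil_in S)// ler_pM2r ?invr_gt0// !phiO//.
    have ? := kxy _ Oy xy.
    have : G (k y)%:R <= G (t + 1) by apply: Gmono => //; lra.
    by rewrite -/t; lra.
  apply: (@le_trans _ _ 0).
    rewrite pmulr_lle0 ?invr_gt0 ?rho_gt0// phib// phiO// -/t.
    by have := C0 _ by_; lra.
  by rewrite divr_ge0 ?(ltW eps0)//; lra.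
have dn : (G t - G (t - 1)) / eps <= slope (\- phi) x.
  apply: le_trans (slope_ub Ox (bounded_onN bphi) xz) => /=.
  have [bz|[Oz kz]] := hz.
    rewrite phib// phiO// -/t.
    apply: (@le_trans _ _ (G t / rho x z)); last first.
      by rewrite ler_div_rho//; have := C0 _ bz; lra.
    apply: (@le_trans _ _ (G t / eps)).
      by rewrite ler_pM2r ?invr_gt0//; lra.
    rewrite ler_wpM2l//; first by lra.
    by rewrite lef_pV2 ?posrE ?rho_gt0// (stencil_bd S).
  rewrite (stencil_in S)// ler_pM2r ?invr_gt0// !phiO// -/t.
  have kz1 : (k z)%:R <= t - 1 :> R.
    by rewrite lerBrDr natr1 ler_nat.
  have : G (k z)%:R <= G (t - 1) by apply: Gmono => //; lra.
  by lra.
have : slope_gap phi x >= (G t - G (t - 1)) / eps - (G (t + 1) - G t) / eps.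
  by rewrite /slope_gap; lra.
apply: le_trans; rewrite -mulrBl.
have -> : G t - G (t - 1) - (G (t + 1) - G t) = 2 * A * eps.
  by rewrite /G aE; ring.
by rewrite mulfK ?gt_eqF//; lra.
Qed.

Definition solution h g u :=
  [/\ bounded_on u, forall x, Om x -> slope_gap u x = h x
    & forall x, bd x -> u x = g x].

Lemma solution_exists h g H C : (forall x, Om x -> `|h x| <= H) ->
  (forall x, bd x -> `|g x| <= C) -> exists u, solution h g u.
Proof.
move=> hH gC; have H0 : 0 <= `|H| + 1 by rewrite addr_ge0.
have hH' x : Om x -> - `|H| <= h x <= `|H|.
  move=> /hH; rewrite ler_norml => /andP[? ?]; have ? := ler_norm H.
  by apply/andP; split; lra.
have [phi [bphi phiO phib]] := barrier H0 gC.
have [|psi [bpsi psiO psib]] := @barrier (\- g) _ C H0.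
  by move=> x /gC /=; rewrite normrN.
have [B hB] := bphi.
have leB w : subsolution h g w ->
    forall x, Om x \/ bd x -> w x <= B.
  move=> [bw wO wb] x Dx; have /ler_normlP[_] := hB _ Dx; apply: le_trans.
  case: Dx => [Ox|bx]; last by rewrite wb// phib.
  apply: (@comparison w phi 1) => // y Yy; last by rewrite wb// phib.
  by have := phiO _ Yy; have := wO _ Yy; have := hH' _ Yy; lra.
have sub0 : subsolution h g (\- psi).
  split=> [|x Ox|x bx]; first exact: bounded_onN.
    by rewrite slope_gapN; have := psiO _ Ox; have := hH' _ Ox; lra.
  by rewrite /= psib//= opprK.
exists (perron h g); split.
- exact: (perron_bounded leB sub0).
- move=> x Ox; apply/eqP; rewrite eq_le.
  rewrite (perron_sub leB sub0)//.
  by rewrite (perron_super leB sub0).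
- by move=> x bx; apply: (perron_boundary sub0).
Qed.

End Existence.

(** * Two solutions for the same right-hand side *)

(** Both slopes of u and v at x obey one-sided comparisons by contact, and the
    common value of the slope gap turns these into an almost equality.  Let y
    almost attain the upward slope of v.  It cannot be a boundary point: there
    u y = v y, so u would have from x a slope exceeding that of v by
    (M - e) / eps, up to an error e / eps. *)
Lemma gap_step u v x M e : bounded_on u -> bounded_on v -> Om x ->
    slope_gap u x = slope_gap v x -> (forall y, bd y -> u y = v y) ->
    (forall y, Om y -> v y - u y <= M) -> 0 < e -> 3 * e < M ->
    M - e <= v x - u x ->
  slope u x <= slope v x + e / eps /\
  exists y, [/\ Om y, M - 3 * e <= v y - u y
               & v x + eps * slope v x - e <= v y].
Proof.
move=> bu bv Ox uvx uvb hM e0 eM xM.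
have e1 : 0 < e / eps by rewrite divr_gt0.
have dn : slope (\- u) x <= slope (\- v) x + e / eps.
  apply: contact_slope => // [||y Oy|y /uvb] /=.
  - exact: bounded_onN.
  - exact: ltW.
  - by have := hM _ Oy; lra.
  - by lra.
have up : slope u x <= slope v x + e / eps.
  by move: uvx dn; rewrite /slope_gap; lra.
split => //.
have [y xy vy] := slope_adherent Ox bv e1.
have uy := slope_ub Ox bu xy.
have [Oy|by_] := stencil_cover S Ox xy.
  rewrite (stencil_in S)// ltr_pdivlMr// mulrBl divfK ?gt_eqF// in vy.
  move: uy; rewrite (stencil_in S)// ler_pdivrMr// => uy.
  have : slope u x * eps <= slope v x * eps + e.
    by rewrite -[X in _ + X](@divfK _ eps) ?gt_eqF// -mulrDl ler_pM2r.
  by exists y; split => //; lra.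
suff : (M - e) / eps < 2 * e / eps by rewrite ltr_pM2r ?invr_gt0//; lra.
have : (M - e) / eps <= (v x - u x) / rho x y.
  apply: (@le_trans _ _ ((M - e) / rho x y)); last by rewrite ler_div_rho.
  rewrite ler_wpM2l//; first by lra.
  by rewrite lef_pV2 ?posrE ?rho_gt0// (stencil_bd S).
have -> : (v x - u x) / rho x y = (u y - u x) / rho x y - (v y - v x) / rho x y.
  by rewrite (uvb _ by_) -mulrBl; congr (_ / _); ring.
by rewrite -mulrA; lra.
Qed.

(** Otherwise the upward slope of u, and so that of v, is at least about
    M / eps wherever v - u almost equals M.  Each uphill step then raises v by
    M / 2 and multiplies the loss in the gap by 3; starting from a loss of
    M / (8 * 3 ^ j) one can take j steps, which exceeds the bound on v when j
    is large. *)
Lemma gap_top u v : bounded_on u -> bounded_on v ->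
    (forall x, Om x -> slope_gap u x = slope_gap v x) ->
    (forall y, bd y -> u y = v y) ->
    (exists2 x, Om x & u x < v x) ->
  exists2 x, Om x & u x + eps * slope u x < v x.
Proof.
move=> bu bv uv uvb [x0 Ox0 x0uv]; apply: contrapT => no.
have {}no x : Om x -> v x <= u x + eps * slope u x.
  by move=> Ox; rewrite leNgt; apply/negP => lt; apply: no; exists x.
have [M [hM M0 hadh]] := gap_sup bv bu Ox0.
have {}M0 : 0 < M by lra.
have [C hC] := bv.
have e0 j : 0 < M / 8 / 3 ^+ j by rewrite !divr_gt0// exprn_gt0.
have e1 j : M / 8 / 3 ^+ j <= M / 8.
  by rewrite ler_pdivrMr ?exprn_gt0// ler_peMr// ?exprn_ege1//; lra.
have climb j : forall x, Om x -> M - M / 8 / 3 ^+ j <= v x - u x ->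
    v x <= C - j%:R * (M / 2).
  elim: j => [x Ox _|j IH x Ox xM].
    by have /ler_normlP[_] := hC _ (or_introl Ox); lra.
  have e0j := e0 j.+1; have e1j := e1 j.+1.
  have E3 : 3 * (M / 8 / 3 ^+ j.+1) = M / 8 / 3 ^+ j.
    by rewrite exprS; field; rewrite expf_neq0.
  set e := M / 8 / 3 ^+ j.+1 in xM e0j e1j E3.
  have [|up [y [Oy yM vy]]] :=
      gap_step bu bv Ox (uv _ Ox) uvb hM e0j _ xM; first lra.
  rewrite E3 in yM; have vyC := IH y Oy yM.
  have up' : eps * slope u x <= eps * slope v x + e.
    rewrite -[X in _ + X](@divfK _ eps) ?gt_eqF// [_ / eps * _]mulrC -mulrDr.
    by rewrite ler_pM2l.
  have := no _ Ox; rewrite -natr1 mulrDl; lra.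
have [x Ox xM] := hadh _ (e0 (Num.truncn ((C + C) / (M / 2))).+1).
have := climb _ x Ox (ltW xM); rewrite leNgt => /negP; apply.
have : (C + C) / (M / 2) < (Num.truncn ((C + C) / (M / 2))).+1%:R.
  by rewrite truncnS_gt.
rewrite ltr_pdivrMr; last lra.
by have /ler_normlP[] := hC _ (or_introl Ox); lra.
Qed.

Lemma subsingleton_countable (A : set R) :
  (forall a b, A a -> A b -> a = b) -> countable A.
Proof.
move=> A1; have [[a Aa]|nA] := pselect (exists a, A a); last first.
  suff -> : A = set0 by exact: countable0.
  by rewrite -subset0 => a Aa; apply: nA; exists a.
apply: (@sub_countable _ _ _ [set a]); last exact: countable1.
by apply: subset_card_le => b Ab; exact: A1.
Qed.

(** The set of exceptional c is covered by the sets N (i, q), each of which has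
    at most one element.  Indeed, if c < c', then solutions for c' lie above
    solutions for c; but some solution for c exceeds q at a point of Q i, and
    some solution for c' is at most q there. *)
Lemma nonuniqueness_countable (I : countType) (Q : I -> set T) f g :
    (forall x, Om x -> exists i, [/\ Q i x, Q i `<=` Om & Q i `<=` nb x]) ->
  countable [set c | exists u v,
    [/\ solution (fun x => eps * (f x + c)) g u,
        solution (fun x => eps * (f x + c)) g v
      & exists2 x, Om x & u x < v x]].
Proof.
move=> hQ.
pose N (p : I * rat) := [set c | exists u v,
  [/\ solution (fun x => eps * (f x + c)) g u,
      solution (fun x => eps * (f x + c)) g v, Q p.1 `<=` Om,
      forall y, Q p.1 y -> u y <= ratr p.2 &
      exists2 y, Q p.1 y & ratr p.2 < v y]].
apply: (@sub_countable _ _ _ (\bigcup_(p in setT) N p)).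
  apply: subset_card_le => c [u [v [su sv uv]]].
  have [bu uO ub] := su; have [bv vO vb] := sv.
  have [x Ox ltx] : exists2 x, Om x & u x + eps * slope u x < v x.
    apply: gap_top => // [x Ox|x bx]; first by rewrite uO ?vO.
    by rewrite ub ?vb.
  have [i [Qx QO Qnb]] := hQ x Ox.
  have [q] := rat_in_itvoo ltx; rewrite in_itv/= => /andP[q1 q2].
  exists (i, q) => //; exists u, v; split => //; last by exists x.
  move=> y Qy; have := slope_increment Ox (QO _ Qy) bu (Qnb _ Qy).
  by lra.
apply: bigcup_countable => // p _.
have lt_false c c' : N p c -> N p c' -> c < c' -> False.
  move=> [_ [v [_ [bv vO vb] QO _ [y Qy qv]]]].
  move=> [u [_ [[bu uO ub] _ _ qu _]]] cc'.
  have d0 : 0 < eps * (c' - c) by rewrite mulr_gt0// subr_gt0.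
  have := comparison bv bu d0.
  move=> /(_ _ _ _ (QO _ Qy)) H.
  have : v y <= u y.
    apply: H => x Dx; last by rewrite ub ?vb.
    by rewrite vO// uO//; lra.
  by have := qu _ Qy; lra.
apply: subsingleton_countable => a b Na Nb; apply/eqP; case: ltgtP => //.
- by move/(lt_false _ _ Na Nb).
- by move/(lt_false _ _ Nb Na).
Qed.

End Stencil.

(** * Lengths of paths and path distance *)

Section EuclideanNorm.
Context {R : realType} {n : nat}.
Implicit Types x y : 'rV[R]_n.

Lemma enormB x y : enorm (x - y) = enorm (y - x).
Proof.
congr Num.sqrt; apply: eq_bigr => i _.
by rewrite !mxE -sqrrN opprB.
Qed.

Lemma coord_le_norm x i : `|x ord0 i| <= `|x|.
Proof.
rewrite [leRHS]/Num.Def.normr/= mx_normrE.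
exact: (le_bigmax _ (fun ij => `|x ij.1 ij.2|) (ord0, i)).
Qed.

Lemma norm_le_coord x c : 0 <= c -> (forall i, `|x ord0 i| <= c) -> `|x| <= c.
Proof.
move=> c0 xc; rewrite [leLHS]/Num.Def.normr/= mx_normrE (bigmax_le _ c0)//=.
by move=> [i j] _ /=; rewrite ord1.
Qed.

Lemma norm_le_enorm x : `|x| <= enorm x.
Proof.
apply: norm_le_coord; first exact: sqrtr_ge0.
move=> i; rewrite -sqrtr_sqr ler_wsqrtr// (bigD1 i)//= lerDl sumr_ge0// => j _.
exact: sqr_ge0.
Qed.

Lemma enorm_le_norm x : enorm x <= n%:R * `|x|.
Proof.
have sumle : \sum_(i < n) `|x ord0 i| <= n%:R * `|x|.
  apply: (@le_trans _ _ (\sum_(i < n) `|x|)).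
    by apply: ler_sum => i _; exact: coord_le_norm.
  by rewrite sumr_const card_ord mulr_natl.
apply: le_trans sumle.
have sum0 : 0 <= \sum_(i < n) `|x ord0 i| by apply: sumr_ge0.
rewrite -(ger0_norm sum0) -sqrtr_sqr ler_wsqrtr//.
rewrite expr2 mulr_suml ler_sum// => i _.
rewrite -[X in X <= _]ger0_norm ?sqr_ge0// normrX expr2 ler_wpM2l//.
by rewrite (bigD1 i)//= lerDl sumr_ge0.
Qed.

End EuclideanNorm.

Section Polygon.
Context {R : realType} {n : nat}.
Implicit Types (gamma : R -> 'rV[R]_n) (a b t : R) (s : seq R).

(** Recursive form of the sums in [path_length], with the starting point of the
    subdivision as an explicit argument. *)
Fixpoint polygon_length gamma a s : R :=
  if s is b :: s' then enorm (gamma b - gamma a) + polygon_length gamma b s'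
  else 0.

Lemma polygon_lengthE gamma a s :
  \sum_(0 <= k < size s)
    enorm (gamma (nth 1 (a :: s) k.+1) - gamma (nth 1 (a :: s) k)) =
  polygon_length gamma a s.
Proof.
elim: s a => [|b s IH] a; first by rewrite big_nil.
by rewrite big_nat_recl//= -IH.
Qed.

Lemma polygon_length_comp gamma (f : R -> R) a s :
  polygon_length (gamma \o f) a s = polygon_length gamma (f a) (map f s).
Proof. by elim: s a => [//|b s IH] a /=; rewrite IH. Qed.

Lemma polygon_length_cat gamma a s s' :
  polygon_length gamma a (s ++ s') =
  polygon_length gamma a s + polygon_length gamma (last a s) s'.
Proof.
by elim: s a => [|b s IH] a /=; [rewrite add0r|rewrite IH addrA].
Qed.

Lemma polygon_length_rev gamma a s :
  polygon_length gamma (last a s) (rev (belast a s)) = polygon_length gamma a s.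
Proof.
elim: s a => [//|b s IH] a.
rewrite [last _ _]/= [belast _ _]/= rev_cons -cats1 polygon_length_cat IH /=.
rewrite addr0 enormB addrC; congr (enorm (_ - _) + _); congr gamma.
by case: s {IH} => [//|c s] /=; rewrite rev_cons last_rcons.
Qed.

Lemma polygon_length_le gamma C a s :
    (forall t t', 0 <= t -> t <= t' -> t' <= 1 ->
      enorm (gamma t' - gamma t) <= C * (t' - t)) ->
    path <%R a s -> 0 <= a -> last a s <= 1 ->
  polygon_length gamma a s <= C * (last a s - a).
Proof.
move=> hC; elim: s a => [|b s IH] a /=; first by rewrite subrr mulr0.
move=> /andP[ab bs] a0 l1.
have bl : b <= last b s by apply: (@itv_partition_le _ _ _ _ s); split.
have -> : C * (last b s - a) = C * (b - a) + C * (last b s - b) by ring.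
by rewrite lerD// ?hC ?IH//; lra.
Qed.

Lemma path_length_ub gamma s : itv_partition 0 1 s ->
  ((polygon_length gamma 0 s)%:E <= path_length gamma)%E.
Proof.
by move=> sP; apply: ereal_sup_ubound; exists s; rewrite ?polygon_lengthE.
Qed.

Lemma path_length_le gamma (C : \bar R) :
    (forall s, itv_partition 0 1 s -> ((polygon_length gamma 0 s)%:E <= C)%E) ->
  (path_length gamma <= C)%E.
Proof.
by move=> H; apply: ge_ereal_sup => _ [s sP <-]; rewrite polygon_lengthE H.
Qed.

Lemma path_length_gt gamma c : (c%:E < path_length gamma)%E ->
  exists2 s, itv_partition 0 1 s & c < polygon_length gamma 0 s.
Proof.
move=> /ereal_sup_gt[_ [s sP <-]]; rewrite polygon_lengthE lte_fin => cs.
by exists s.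
Qed.

Lemma path_length_ge gamma :
  ((enorm (gamma 1 - gamma 0))%:E <= path_length gamma)%E.
Proof.
have := @path_length_ub gamma [:: 1].
by rewrite /= addr0; apply; exact: itv_partition1.
Qed.

Lemma path_length_reverse gamma :
  (path_length (fun t => gamma (1 - t)%R) <= path_length gamma)%E.
Proof.
apply: path_length_le => s [ps /eqP ls].
rewrite (polygon_length_comp gamma (fun t => 1 - t)) -polygon_length_rev.
set s' := map _ s.
have l0 : last (1 - 0) s' = 0.
  by rewrite /s' (last_map (fun t => 1 - t)) ls subrr.
rewrite l0; apply: path_length_ub; split.
  rewrite -[X in path _ X _]l0 rev_path; apply: homo_path ps => u v uv.
  by rewrite ltrD2l ltrN2.
case: s' l0 => [/= /eqP|b s' _]; first by rewrite subr0 oner_eq0.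
by rewrite [belast _ _]/= rev_cons last_rcons subr0.
Qed.

Definition subpath gamma a b t := gamma (a + t * (b - a)).

(** Superadditivity of the length: subdivisions of [0, t] and [t, 1] concatenate
    to one of [0, 1].  Stated for a lower bound c of the first length, so that
    no finiteness of that length has to be discussed. *)
Lemma path_length_split gamma t (c L : R) : 0 < t < 1 ->
    (path_length gamma <= L%:E)%E ->
    (c%:E < path_length (subpath gamma 0%R t))%E ->
  (path_length (subpath gamma t 1%R) <= (L - c)%:E)%E.
Proof.
move=> /andP[t0 t1] gL /path_length_gt[s1 [p1 /eqP l1] cs1].
apply: path_length_le => s2 [p2 /eqP l2].
rewrite lee_fin lerBrDr; apply: le_trans (_ : polygon_length gamma 0
  (map (fun r => 0 + r * (t - 0)) s1 ++
   map (fun r => t + r * (1 - t)) s2) <= _).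
  rewrite polygon_length_cat addrC.
  have -> : last 0 [seq 0 + r * (t - 0) | r <- s1] = t.
    rewrite -[X in last X _](_ : 0 + 0 * (t - 0) = 0); last ring.
    by rewrite (last_map (fun r => 0 + r * (t - 0))) l1; ring.
  rewrite lerD//.
    apply: ltW; apply: lt_le_trans cs1 _.
    by rewrite (polygon_length_comp gamma (fun r => _)) mul0r addr0.
  by rewrite (polygon_length_comp gamma (fun r => _)) mul0r addr0.
rewrite -lee_fin; apply: le_trans gL; apply: path_length_ub.
apply: (@itv_partition_cat _ _ _ t); split.
- rewrite -[X in path _ X _](_ : 0 + 0 * (t - 0) = 0); last ring.
  by apply: homo_path p1 => u v uv; rewrite ltrD2l ltr_pM2r//; lra.
- rewrite -[X in last X _](_ : 0 + 0 * (t - 0) = 0); last ring.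
  by rewrite (last_map (fun r => 0 + r * (t - 0))) l1; apply/eqP; ring.
- rewrite -[X in path _ X _](_ : t + 0 * (1 - t) = t); last ring.
  by apply: homo_path p2 => u v uv; rewrite ltrD2l ltr_pM2r//; lra.
- rewrite -[X in last X _](_ : t + 0 * (1 - t) = t); last ring.
  by rewrite (last_map (fun r => t + r * (1 - t))) l2; apply/eqP; ring.
Qed.

End Polygon.

Section LipschitzPath.
Context {R : realType} {n : nat}.
Implicit Types (Omega : set 'rV[R]_n) (x y : 'rV[R]_n) (gamma : R -> 'rV[R]_n).

Lemma lipschitz_itvP gamma : [lipschitz gamma t | t in `[0, 1]] <->
  exists2 M, 0 < M & forall s t, 0 <= s <= 1 -> 0 <= t <= 1 ->
    `|gamma s - gamma t| <= M * `|s - t|.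
Proof.
split=> [/pinfty_ex_gt0[M M0 hM]|[M M0 hM]].
  exists M => // s t hs ht.
  by apply: (hM (s, t)); split; rewrite /= in_itv.
apply: (@klipschitzW _ _ _ M).
  apply: (@globally_properfilter _ _ (0, 0)).
  by split; rewrite /= in_itv /= lexx ler01.
by move=> [s t] [/= hs ht]; apply: hM; [move: hs|move: ht]; rewrite in_itv.
Qed.

Lemma lipschitz_path_comp Omega gamma x y (f : R -> R) :
    lipschitz_path Omega x y gamma ->
    (forall t, 0 <= t <= 1 -> 0 <= f t <= 1) ->
    (forall s t, `|f s - f t| <= `|s - t|) ->
  lipschitz_path Omega (gamma (f 0)) (gamma (f 1)) (gamma \o f).
Proof.
move=> [/lipschitz_itvP[M M0 hM] cl _ _] f01 fL.
split=> [|t ht||]; [|exact/cl/f01|by []|by []].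
apply/lipschitz_itvP; exists M => // s t hs ht /=.
by apply: le_trans (hM _ _ (f01 _ hs) (f01 _ ht)) _; rewrite ler_pM2l.
Qed.

Lemma lipschitz_path_sub Omega gamma x y a b :
    lipschitz_path Omega x y gamma -> 0 <= a -> a <= b -> b <= 1 ->
  lipschitz_path Omega (gamma a) (gamma b) (subpath gamma a b).
Proof.
move=> g a0 ab b1.
have := lipschitz_path_comp (f := fun t => a + t * (b - a)) g.
rewrite mul0r addr0 mul1r subrKC; apply.
- move=> t /andP[t0 t1].
  have := mulr_ge0 t0 (_ : 0 <= b - a).
  have := mulr_ge0 (_ : 0 <= 1 - t) (_ : 0 <= b - a).
  rewrite !subr_ge0 => /(_ t1 ab) h1 /(_ ab) h2; apply/andP; split; lra.
- move=> s t.
  have -> : a + s * (b - a) - (a + t * (b - a)) = (s - t) * (b - a) by ring.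
  by rewrite normrM ler_piMr// ger0_norm; lra.
Qed.

Lemma lipschitz_path_reverse Omega gamma x y :
  lipschitz_path Omega x y gamma ->
  lipschitz_path Omega y x (fun t => gamma (1 - t)).
Proof.
move=> g; have [_ _ g0 g1] := g.
have := lipschitz_path_comp (f := fun t => 1 - t) g.
rewrite subr0 subrr g0 g1; apply.
- by move=> t /andP[? ?]; apply/andP; split; lra.
- by move=> s t; rewrite distrC; rewrite opprB addrC subrKA.
Qed.

Lemma path_length_le_lipschitz gamma M : 0 <= M ->
    (forall s t, 0 <= s <= 1 -> 0 <= t <= 1 ->
      `|gamma s - gamma t| <= M * `|s - t|) ->
  (path_length gamma <= (n%:R * M)%:E)%E.
Proof.
move=> M0 hM; apply: path_length_le => s [ps /eqP ls]; rewrite lee_fin.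
have := @polygon_length_le R n gamma (n%:R * M) 0 s; rewrite ls subr0 mulr1.
apply=> // t t' t0 tt' t1.
apply: le_trans (enorm_le_norm _) _; rewrite -mulrA ler_wpM2l//.
have := hM t' t; rewrite (ger0_norm (_ : 0 <= t' - t)) ?subr_ge0//.
by apply; apply/andP; split; lra.
Qed.

Lemma path_edist_le Omega x y gamma : lipschitz_path Omega x y gamma ->
  (path_edist Omega x y <= path_length gamma)%E.
Proof. by move=> g; apply: ereal_inf_lbound; exists gamma. Qed.

Lemma path_edist_ge Omega x y : ((`|x - y|)%:E <= path_edist Omega x y)%E.
Proof.
apply: le_ereal_inf_tmp => _ [gamma [_ _ g0 g1] <-].
apply: le_trans (path_length_ge _); rewrite lee_fin g0 g1 distrC.
exact: norm_le_enorm.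
Qed.

Lemma path_edist_sym Omega x y : path_edist Omega x y = path_edist Omega y x.
Proof.
suff le a b : (path_edist Omega a b <= path_edist Omega b a)%E.
  by apply/eqP; rewrite eq_le !le.
apply: le_ereal_inf_tmp => _ [gamma g <-].
apply: le_trans (path_length_reverse _).
exact/path_edist_le/lipschitz_path_reverse.
Qed.

(** The factor n compares the Euclidean norm with the maximum norm. *)
Lemma path_edist_segment Omega x y :
    (forall t, 0 <= t <= 1 -> closure Omega (x + t *: (y - x))) ->
  (path_edist Omega x y <= (n%:R * `|x - y|)%:E)%E.
Proof.
move=> cl; pose gamma t := x + t *: (y - x).
have gL s t : `|gamma s - gamma t| <= `|x - y| * `|s - t|.
  rewrite /gamma opprD addrACA subrr add0r -scalerBl normrZ mulrC.
  by rewrite (distrC y).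
apply: le_trans (@path_edist_le _ x y gamma _) _.
  split.
  - apply/lipschitz_itvP; exists (`|x - y| + 1); first by rewrite ltr_wpDl.
    move=> s t _ _; apply: le_trans (gL _ _) _.
    by rewrite ler_wpM2r// lerDl.
  - by move=> t; rewrite in_itv; exact: cl.
  - by rewrite /gamma scale0r addr0.
  - by rewrite /gamma scale1r subrKC.
exact: path_length_le_lipschitz.
Qed.

End LipschitzPath.

(** * Stencil of a bounded open set *)

Lemma boundedP {R : realType} {T : Type} {V : normedModType R}
    (A : set T) (f : T -> V) :
  [bounded f x | x in A] <-> exists B, forall x, A x -> `|f x| <= B.
Proof.
split=> [/pinfty_ex_gt0[B _ hB]|[B hB]]; first by exists B.
exists B; split=> [|M BM x Ax]; first exact: num_real.
exact: le_trans (hB _ Ax) (ltW BM).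
Qed.

Section Domain.
Context {R : realType} {n : nat}.
Context {Omega : set 'rV[R]_n} {eps : R}.
Context (n_gt0 : (0 < n)%N).
Context (bO : bounded_set Omega).
Context (oO : open Omega).
Context (dO : (path_diam Omega < +oo)%E).
Context (eps0 : 0 < eps).
Implicit Types (x y : 'rV[R]_n) (gamma : R -> 'rV[R]_n).

Local Notation ball_eps := (fun x => path_cball Omega x eps).
Local Notation reach := (@reach _ (boundary Omega) ball_eps).

Lemma path_edist_fin x y : closure Omega x -> closure Omega y ->
  path_edist Omega x y = (path_dist Omega x y)%:E.
Proof.
move=> cx cy; rewrite /path_dist fineK// ge0_fin_numE.
  apply: le_lt_trans dO; apply: ereal_sup_ubound.
  by exists (x, y).
by apply: le_trans (path_edist_ge Omega x y); rewrite lee_fin.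
Qed.

Lemma path_dist_le x y (c : R) : closure Omega x -> closure Omega y ->
  (path_edist Omega x y <= c%:E)%E -> path_dist Omega x y <= c.
Proof. by move=> cx cy; rewrite path_edist_fin. Qed.

Lemma path_dist_ge x y : closure Omega x -> closure Omega y ->
  `|x - y| <= path_dist Omega x y.
Proof.
by move=> cx cy; rewrite -lee_fin -path_edist_fin//; exact: path_edist_ge.
Qed.

Lemma open_ball x : Omega x -> exists2 r, 0 < r &
  forall y, `|x - y| < r -> Omega y.
Proof.
move=> Ox; have : nbhs x Omega by apply: open_nbhs_nbhs; split.
move=> /nbhs_ballP[r /= r0 hr]; exists r => // y xy; apply: hr.
by rewrite -ball_normE.
Qed.

Lemma path_dist_ball x r y : (forall y, `|x - y| < r -> Omega y) ->
  `|x - y| < r -> path_dist Omega x y <= n%:R * `|x - y|.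
Proof.
move=> hr xy; have sC := @subset_closure _ Omega.
have cx : closure Omega x.
  by apply/sC/hr; rewrite subrr normr0; apply: le_lt_trans xy.
apply: path_dist_le => //; first exact/sC/hr.
apply: path_edist_segment => t /andP[t0 t1]; apply/sC/hr.
rewrite opprD addrA subrr add0r normrN normrZ ger0_norm// distrC.
by apply: le_lt_trans xy; rewrite ler_piMl.
Qed.

Lemma bounded_closure : bounded_set (closure Omega).
Proof.
move: bO => /boundedP[M hM]; apply/boundedP; exists M => x /= cx.
rewrite leNgt; apply/negP => Mx.
have : nbhs x (ball x (`|x| - M)) by apply: nbhsx_ballx; lra.
move=> /cx[y [Oy]]; rewrite -ball_normE /= => xy.
have := hM y Oy; have := ler_normD (x - y) y; rewrite subrK /=; lra.
Qed.

Lemma compact_closure : compact (closure Omega).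
Proof.
apply: bounded_closed_compact; first exact: bounded_closure.
exact: closed_closure.
Qed.

Lemma compact_boundary : compact (boundary Omega).
Proof.
apply: subclosed_compact compact_closure _; last by move=> x [].
rewrite /boundary setDE; apply: closedI; first exact: closed_closure.
by apply: open_closedC; exact: open_interior.
Qed.

Lemma boundaryP x : boundary Omega x <-> closure Omega x /\ ~ Omega x.
Proof. by rewrite /boundary (interior_id _).1. Qed.

(** A point of the closure that maximizes a coordinate cannot be interior. *)
Lemma boundary_nonempty : Omega !=set0 -> boundary Omega !=set0.
Proof.
move=> [x0 Ox0]; pose i := Ordinal n_gt0.
have [||c] := @EVT_max_rV R n (fun x => x ord0 i) _ _ compact_closure.
- by exists x0; exact: subset_closure.
- by apply: continuous_subspaceT => x; exact: coord_continuous.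
rewrite inE => cc cmax; exists c; apply/boundaryP; split=> // Oc.
have [r r0 hr] := open_ball Oc.
pose y := c + (r / 2) *: delta_mx ord0 i.
have : Omega y.
  apply: hr; rewrite /y opprD addrA subrr add0r normrN normrZ.
  rewrite gtr0_norm ?divr_gt0//.
  apply: (@le_lt_trans _ _ (r / 2 * 1)); last lra.
  rewrite ler_wpM2l//; first by rewrite divr_ge0// ltW.
  apply: norm_le_coord => // j; rewrite mxE eqxx /=.
  by case: eqP; rewrite ?normr1 ?normr0.
move=> /(@subset_closure _ Omega)/mem_set/cmax.
by rewrite /y !mxE !eqxx mulr1; lra.
Qed.

Lemma domain_stencil :
  stencil Omega (boundary Omega) ball_eps (rho Omega eps) eps.
Proof.
have sC := @subset_closure _ Omega.
have rhoI x y : Omega x -> Omega y -> path_dist Omega x y <= eps ->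
    rho Omega eps x y = eps.
  move=> Ox Oy xy; rewrite /rho !mem_set//=; exact: max_r.
have rhoB x y : ~ Omega y -> rho Omega eps x y = path_dist Omega x y.
  by move=> nOy; rewrite /rho (memNset nOy) andbF.
split => //.
- move=> x Ox; split; first exact: sC.
  have [r r0 hr] := open_ball Ox.
  apply: le_trans (path_dist_ball (y := x) hr _) _;
    rewrite subrr normr0 ?mulr0//.
  exact: ltW.
- move=> x y Ox [cy _]; have [Oy|nOy] := pselect (Omega y); first by left.
  by right; apply/boundaryP.
- by move=> x Ox /boundaryP[].
- by move=> x y Ox [_ xy] Oy; exact: rhoI.
- by move=> x y Ox [_ xy] /boundaryP[_ nOy]; rewrite rhoB.
- move=> x Ox; have [r r0 hr] := open_ball Ox.
  exists (Num.min r eps); first by rewrite lt_min r0.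
  move=> y [cy xy]; have [Oy|nOy] := pselect (Omega y).
    by rewrite rhoI// ge_min lexx orbT.
  rewrite rhoB// ge_min; apply/orP; left.
  apply: le_trans (path_dist_ge (sC _ Ox) cy).
  by rewrite leNgt; apply/negP => /hr.
Qed.

Lemma path_cball_sym x y : closure Omega x -> path_cball Omega x eps y ->
  path_cball Omega y eps x.
Proof. by move=> cx [cy]; rewrite /path_cball /= /path_dist path_edist_sym. Qed.

Lemma reach_le m m' x : (m <= m')%N -> reach m x -> reach m' x.
Proof.
elim: m m' x => [|m IH] [|m'] x //= mm'; first by left.
by move=> [bx|[y xy ry]]; [left|right; exists y => //; exact: IH].
Qed.

(** Each round spends at least eps / 2 of the length and takes two steps.  Along
    a uniform subdivision of [0, 1] so fine that consecutive points are at path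
    distance at most eps, take the first point t (i + 1) such that the path up
    to it is longer than eps / 2.  The path up to t i has length at most
    eps / 2, which gives the first step; the second one goes from t i to
    t (i + 1).  Going through t i avoids any subadditivity of the length. *)
Lemma reach_path (j : nat) x y gamma : lipschitz_path Omega x y gamma ->
    boundary Omega y -> (path_length gamma <= (j%:R * (eps / 2))%:E)%E ->
  reach j.*2.+1 x.
Proof.
have eps2 : eps / 2 < eps by rewrite ltr_pdivrMr ?ltr_pMr ?ltr1n.
elim: j x y gamma => [|j IH] x y gamma g byy len.
  right; exists y; last by [].
  have [_ cl g0 g1] := g; have cx : closure Omega x.
    by rewrite -g0; apply: cl; rewrite in_itv /= lexx ler01.
  have cy : closure Omega y.
    by rewrite -g1; apply: cl; rewrite in_itv /= lexx ler01.
  split=> //; apply: path_dist_le => //; apply: le_trans (path_edist_le g) _.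
  by apply: le_trans len _; rewrite mul0r lee_fin ltW.
have [/lipschitz_itvP[M M0 hM] cl g0 g1] := g.
have {}cl t : 0 <= t <= 1 -> closure Omega (gamma t).
  by move=> ht; apply: cl; rewrite in_itv.
pose m := Num.truncn (n%:R * M / eps).
have mM : n%:R * M < m.+1%:R * eps.
  by rewrite -ltr_pdivrMr//; exact: truncnS_gt.
pose t (i : nat) : R := i%:R / m.+1%:R.
have t0 : t 0 = 0 by rewrite /t mul0r.
have t1 : t m.+1 = 1 by rewrite /t divff.
have tS i : t i.+1 = t i + m.+1%:R^-1 by rewrite /t -natr1 mulrDl mul1r.
have t01 i : (i <= m.+1)%N -> 0 <= t i <= 1.
  by move=> im; rewrite /t divr_ge0//= ler_pdivrMr// mul1r ler_nat.
have dist_sub a b (c : R) : 0 <= a -> a <= b -> b <= 1 ->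
    (path_length (subpath gamma a b) <= c%:E)%E ->
    path_dist Omega (gamma a) (gamma b) <= c.
  move=> a0 ab b1 len_c; apply: path_dist_le.
  - by apply: cl; rewrite a0 (le_trans ab).
  - by apply: cl; rewrite b1 (le_trans a0).
  - exact: le_trans (path_edist_le (lipschitz_path_sub g a0 ab b1)) len_c.
have whole : subpath gamma 0 1 = gamma.
  by apply/funext => s; rewrite /subpath subr0 mulr1 add0r.
have [short|long] := leP (path_length gamma) eps%:E.
  apply: (@reach_le 1) => //; right; exists y; last by [].
  split; first by rewrite -g1; apply: cl; rewrite lexx ler01.
  by rewrite -g0 -g1; apply: dist_sub; rewrite ?whole.
(* The length eps / 2 is exceeded at the latest at t (m + 1) = 1. *)
pose P i := ((eps / 2)%:E < path_length (subpath gamma 0%R (t i)))%E.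
have exP : exists i, P i.
  exists m.+1; rewrite /P t1 whole; apply: lt_trans long.
  by rewrite lte_fin.
have [i Pi minP] := ex_minnP exP.
have im : (i <= m.+1)%N.
  apply: minP; rewrite /P t1 whole; apply: lt_trans long.
  by rewrite lte_fin.
case: i Pi minP im => [|i] Pi minP im.
  move: Pi; rewrite /P t0 ltNge; case/negP.
  apply: le_trans (path_length_le_lipschitz (lexx 0) _) _ => //.
    by move=> s s' _ _; rewrite /subpath subrr !mulr0 subrr normr0 mul0r.
  by rewrite mulr0 lee_fin divr_ge0 ?ltW.
have i01 := t01 i (ltnW im); have /andP[ti_ge0 ti_le1] := i01.
have /andP[tS_ge0 tS_le1] := t01 i.+1 im.
have ti : t i <= t i.+1 by rewrite tS lerDl invr_ge0.
rewrite doubleS; right; exists (gamma (t i)).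
  split; first exact: cl.
  rewrite -g0 -t0; apply: dist_sub; rewrite ?t0//.
  have : ~~ P i by apply/negP => /minP; rewrite ltnn.
  by rewrite /P -leNgt => /le_trans; apply; rewrite lee_fin ltW.
right; exists (gamma (t i.+1)).
  split; first by apply: cl; apply/andP.
  apply: dist_sub => //.
  apply: le_trans (path_length_le_lipschitz (M := M / m.+1%:R) _ _) _.
  - by rewrite divr_ge0// ltW.
  - move=> s s' hs hs'; rewrite /subpath tS [t i + _ - t i]addrC addKr.
    set dt := m.+1%:R^-1; have dt0 : 0 <= dt by rewrite invr_ge0.
    have dE : t i + dt = t i.+1 by rewrite tS.
    have in01 r : 0 <= r <= 1 -> 0 <= t i + r * dt <= 1.
      move=> /andP[r0 r1]; have : r * dt <= dt by rewrite ler_piMl.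
      have : 0 <= r * dt by rewrite mulr_ge0.
      move=> h1 h2; rewrite addr_ge0//=; apply: le_trans tS_le1.
      by rewrite -dE lerD2l.
    apply: le_trans (hM _ _ (in01 _ hs) (in01 _ hs')) _.
    rewrite -mulrA ler_wpM2l ?(ltW M0)//.
    have -> : t i + s * dt - (t i + s' * dt) = (s - s') * dt by ring.
    by rewrite normrM mulrC (ger0_norm dt0).
  - by rewrite lee_fin mulrA ler_pdivrMr// mulrC ltW// mulrC [eps * _]mulrC.
have [ti1|ti1] := eqVneq (t i.+1) 1.
  by apply: (@reach_le 0) => //; rewrite ti1 g1.
have lt1 : t i.+1 < 1 by rewrite lt_neqAle ti1.
have gt0 : 0 < t i.+1 by rewrite /t divr_gt0.
have g' : lipschitz_path Omega (gamma (t i.+1)) y (subpath gamma (t i.+1) 1).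
  by rewrite -g1; exact: lipschitz_path_sub g _ _ _.
apply: IH g' byy _.
have -> : j%:R * (eps / 2) = j.+1%:R * (eps / 2) - eps / 2.
  by rewrite -natr1; ring.
by apply: path_length_split len Pi; rewrite gt0 lt1.
Qed.

(** The same boundary point serves for all x: its path distance to x is at most
    the path diameter, which bounds the number of rounds in [reach_path]. *)
Lemma uniform_reach : exists K, forall x, Omega x -> reach K x.
Proof.
have [[x0 Ox0]|] := pselect (Omega !=set0); last first.
  by move=> O0; exists 0 => x Ox; case: O0; exists x.
have [y byy] : boundary Omega !=set0 by apply: boundary_nonempty; exists x0.
have [cy _] := byy.
have [L hL] : exists L : R, forall x, Omega x ->
    (path_edist Omega x y < L%:E)%E.
  exists (fine (path_diam Omega) + 1) => x Ox.
  have xD : (path_edist Omega x y <= path_diam Omega)%E.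
    apply: ereal_sup_ubound; exists (x, y) => //; split => //.
    exact: subset_closure.
  have D0 : (0 <= path_diam Omega)%E.
    apply: le_trans xD; apply: le_trans (path_edist_ge Omega x y).
    by rewrite lee_fin.
  apply: le_lt_trans xD _; rewrite -[ltLHS]fineK ?ge0_fin_numE//.
  by rewrite lte_fin ltrDl.
exists (Num.truncn (L / (eps / 2))).+1.*2.+1 => x Ox.
have [_ [gamma g <-] len] := ereal_inf_lt (hL x Ox).
apply: reach_path g byy _; apply/ltW/(lt_le_trans len).
by rewrite lee_fin -ler_pdivrMr ?divr_gt0// ltW// truncnS_gt.
Qed.

(** Half-open cubes of side 1 / (m + 1) on the integer grid: a countable family
    with arbitrarily small members around every point. *)
Definition cell (p : nat * 'rV[int]_n) : set 'rV[R]_n :=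
  [set x | forall i, Num.floor (p.1.+1%:R * x ord0 i) = p.2 ord0 i].

Lemma cell_dist p x y : cell p x -> cell p y -> p.1.+1%:R * `|x - y| <= 1.
Proof.
move=> px py; rewrite mulrC -ler_pdivlMr// div1r; apply: norm_le_coord => // i.
rewrite !mxE -[leRHS]mul1r ler_pdivlMr// mulrC.
rewrite -[X in X * _](@gtr0_norm _ p.1.+1%:R)//.
rewrite -normrM mulrBr.
have := floor_itv (p.1.+1%:R * x ord0 i).
have := floor_itv (p.1.+1%:R * y ord0 i).
rewrite px py !intrD => /andP[? ?] /andP[? ?].
by rewrite ler_norml; apply/andP; split; lra.
Qed.

Lemma cell_cover x : Omega x -> exists p,
  [/\ cell p x, cell p `<=` Omega & cell p `<=` ball_eps x].
Proof.
move=> Ox; have [r r0 hr] := open_ball Ox.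
(* Cells of side 1 / (m + 1) < r lie in the ball around x, and points of a
   cell are at path distance at most n / (m + 1) <= eps. *)
pose m := Num.truncn (r^-1 + n%:R / eps).
pose p := (m, \row_i Num.floor (m.+1%:R * x ord0 i)).
have px : cell p x by move=> i; rewrite /= mxE.
have mlt : r^-1 + n%:R / eps < m.+1%:R by exact: truncnS_gt.
have n0 : 0 <= n%:R / eps by rewrite divr_ge0// ltW.
have r'0 : 0 < r^-1 by rewrite invr_gt0.
have close y : cell p y -> `|x - y| < r /\ n%:R * `|x - y| <= eps.
  move=> /(cell_dist px) /= d1; have d0 := normr_ge0 (x - y).
  set d := `|x - y| in d1 d0 *.
  split.
    rewrite ltNge; apply/negP => rd.
    have d_gt0 : 0 < d by exact: lt_le_trans r0 rd.
    have : r^-1 * d < m.+1%:R * d.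
      by rewrite ltr_pM2r//; apply: le_lt_trans mlt; rewrite lerDl.
    have : 1 <= r^-1 * d by rewrite mulrC ler_pdivlMr// mul1r.
    by lra.
  have : n%:R / eps * d <= 1.
    by apply: le_trans d1; rewrite ler_wpM2r//; lra.
  by rewrite mulrAC ler_pdivrMr// mul1r.
exists p; split=> // y /close[xr xe]; first exact: hr.
split; first exact/subset_closure/hr.
exact: le_trans (path_dist_ball hr xr) xe.
Qed.

Lemma inf_laplacianE u x :
    Omega x -> bounded_on u (Om:=Omega) (bd:=boundary Omega) ->
  inf_laplacian Omega eps u x =
  (- (slope_gap u x (nb:=ball_eps) (rho:=rho Omega eps) / eps))%:E.
Proof.
move=> Ox bu; have S := domain_stencil.
have slopeE v : bounded_on v (Om:=Omega) (bd:=boundary Omega) ->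
    ereal_sup [set ((v y - v x) / rho Omega eps x y)%:E
      | y in path_cball Omega x eps] =
    (slope v x (nb:=ball_eps) (rho:=rho Omega eps))%:E.
  move=> bv; rewrite -[X in ereal_sup X]image_comp ereal_sup_EFin//.
    exact: (slope_has_ubound S).
  by exists ((v x - v x) / rho Omega eps x x), x => //; exact: (stencil_self S).
rewrite /inf_laplacian /slope_plus /slope_minus slopeE//.
have -> : [set ((u x - u y) / rho Omega eps x y)%:E
      | y in path_cball Omega x eps] =
    [set (((\- u) y - (\- u) x) / rho Omega eps x y)%:E
      | y in path_cball Omega x eps].
  by apply: eq_imagel => y _ /=; rewrite opprK addrC.
rewrite slopeE; last exact: bounded_onN.
by rewrite -EFinB -EFinM /slope_gap; congr EFin; ring.
Qed.

Lemma bounded_solutionP f g u : bounded_solution Omega eps f g u <->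
  solution (fun x => eps * f x) g u
   (Om:=Omega) (bd:=boundary Omega) (nb:=ball_eps) (rho:=rho Omega eps).
Proof.
have closureE x : closure Omega x <-> Omega x \/ boundary Omega x.
  split=> [cx|[Ox|[]//]]; last exact: subset_closure.
  have [Ox|nOx] := pselect (Omega x); first by left.
  by right; apply/boundaryP.
have bounded_onE : [bounded u x | x in closure Omega] <->
    bounded_on u (Om:=Omega) (bd:=boundary Omega).
  split=> [/boundedP[B hB]|[B hB]].
    by exists B => x /closureE; exact: hB.
  by apply/boundedP; exists B => x /closureE; exact: hB.
have eqE x : Omega x -> bounded_on u (Om:=Omega) (bd:=boundary Omega) ->
    (- inf_laplacian Omega eps u x)%E = (f x)%:E <->
    slope_gap u x (nb:=ball_eps) (rho:=rho Omega eps) = eps * f x.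
  move=> Ox bu; rewrite inf_laplacianE// -EFinN opprK.
  split=> [[<-]|->]; first by rewrite mulrC divfK ?gt_eqF.
  by rewrite mulrAC divff ?gt_eqF// mul1r.
split=> -[bu uO ub].
  have {}bu := bounded_onE.1 bu; split=> // x Ox.
  exact: ((eqE x Ox bu).1 (uO x Ox)).
split=> [|x Ox|//]; first exact: bounded_onE.2.
exact: ((eqE x Ox bu).2 (uO x Ox)).
Qed.

End Domain.

Theorem theorem2p17 (R : realType) (n : nat) (Omega : set 'rV[R]_n)
    (f g : 'rV[R]_n -> R) (eps : R) :
  (0 < n)%N ->
  bounded_set Omega -> connected Omega -> open Omega ->
  (path_diam Omega < +oo)%E ->
  {within Omega, continuous f} -> [bounded f x | x in Omega] ->
  {within boundary Omega, continuous g} ->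
  0 < eps < 1 ->
  exists2 N : set R, countable N &
    forall c : R, ~ N c ->
      exists2 u : 'rV[R]_n -> R,
        bounded_solution Omega eps (fun x => f x + c) g u &
        forall v : 'rV[R]_n -> R,
          bounded_solution Omega eps (fun x => f x + c) g v ->
          {in closure Omega, v =1 u}.
Proof.
move=> n0 bO _ oO dO _ bf cg /andP[eps0 _].
have S := domain_stencil oO dO eps0.
have := nonuniqueness_countable S f g (cell_cover oO dO eps0).
set N := [set c | _] => cN; exists N => // c nNc.
have [F hF] : exists F, forall x, Omega x -> `|f x| <= F.
  by move: bf => /boundedP.
have [C hC] : exists C, forall x, boundary Omega x -> `|g x| <= C.
  have := compact_bounded (continuous_compact cg (compact_boundary bO)).
  by move=> /boundedP[C hC]; exists C => x bx; apply: hC; exists x.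
have [K reachK] := uniform_reach n0 bO oO dO eps0.
have sC := @subset_closure _ Omega.
have [|k hk] := rank_exists S _ reachK.
  by move=> x y Ox Oy; apply: path_cball_sym; exact: sC.
have [|u su] := @solution_exists _ _ _ _ _ _ _ S _ _ hk
  (fun x => eps * (f x + c)) g (eps * (F + `|c|)) C _ hC.
  move=> x Ox; rewrite normrM gtr0_norm// ler_pM2l//.
  by apply: le_trans (ler_normD _ _) _; rewrite lerD2r hF.
exists u; first exact/bounded_solutionP.
move=> v /(bounded_solutionP oO dO eps0) sv x; rewrite inE => cx.
have [Ox|nOx] := pselect (Omega x); last first.
  have bx : boundary Omega x by apply/boundaryP.
  by have [_ _ ub] := su; have [_ _ vb] := sv; rewrite ub// vb.
apply/eqP; case: ltgtP => // lt; case: nNc.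
- by exists v, u; split=> //; exists x.
- by exists u, v; split=> //; exists x.
Qed.
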